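(* The algorithm HTCount-P (described in the context), run with memory budget $M$, has space complexity $O(M)$.
   Context: A hypergraph stream is a sequence of hyperedges, each a nonempty finite set of vertices; $|e|$ is the number of vertices of $e$. Parameters: memory budget $M$ (total number of vertices storable), threshold $\tau\in(0,1)$, maximum number of subsets $N$. Subroutine SampleHyperedge$(e,m,G,M_G,B)$ on a list $G$ with usage $M_G=\sum_{f\in G}|f|$, counter $m$ (already incremented), budget $B$: (a) if $M_G+|e|\le B$ and $|G|=m-1$, append $e$, accepted; (b) otherwise with probability $|G|/m$ remove a uniformly random element of $G$, add $e$, then while $M_G>B$ remove a uniformly random element, accepted; otherwise rejected. HTCount-P maintains $\ell\le N$ (initially $1$) subsets $i$ with list $G_s[i]$ (initially empty), usage $M_s[i]$, allocation $M'[i]$ ($M'[1]=M$, others $0$), counter $m[i]$, flag canExtend (initially true), and three numerical estimates. When $e$ arrives: (1) if $\ell<N$, canExtend, $m[\ell]>|G_s[\ell]|$ and $\sum_{i\le\ell}M_s[i]/M<\tau$: $M'[i]\gets M_s[i]$ for $i\le\ell$, $\ell\gets\ell+1$, $M'[\ell]\gets M-\sum_{i<\ell}M'[i]$, canExtend $\gets$ false. (2) If $\ell=1$ or $\frac{|G_s[\ell]|}{m[\ell]}<\frac1{\ell-1}\sum_{k<\ell}\frac{|G_s[k]|}{m[k]}$ then $p\gets\ell$; else pick $p$ with $\Pr[p=i]=M'[i]/\sum_{j\le\ell}M'[j]$ and canExtend $\gets$ true. (3) $m[p]\gets m[p]+1$; run SampleHyperedge$(e,m[p],G_s[p],M_s[p],M'[p])$;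 if accepted, the estimates are updated by scanning stored hyperedges and computing pairwise and triple intersection sizes with $e$.
   Formalization: The arriving hyperedge counts as input, charged only once stored within budget (adding it before eviction could use |e| far above M), and O(M) is for fixed N: the constant is absolute, but M must exceed a threshold depending on N, since the per-subset counters alone may need order N space. *)

(* Defs.v *)
From mathcomp Require Import all_boot all_order all_algebra finmap.

Set Implicit Arguments.
Unset Strict Implicit.
Unset Printing Implicit Defensive.

Import Order.TTheory GRing.Theory Num.Theory.
Local Open Scope ring_scope.

(* Randomized computations with space accounting: a finite weighted list of
   outcomes (probability, (peak number of words in use, result)).  Probabilities
   multiply along a sequence of steps, and peaks are combined by max. *)
Section Computations.
Context (R : realFieldType).

Definition rcomp (A : Type) := seq (R * (nat * A)).

Definition ret (A : Type) (a : A) : rcomp A := [:: (1, (0%N, a))].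

Definition bind (A B : Type) (c : rcomp A) (k : A -> rcomp B) : rcomp B :=
  flatten [seq [seq (x.1 * y.1, (maxn x.2.1 y.2.1, y.2.2)) | y <- k x.2.2]
          | x <- c].

(* [w] words are in use at this point. *)
Definition occupy (w : nat) : rcomp unit := [:: (1, (w, tt))].

Definition flip (q : R) : rcomp bool :=
  [:: (q, (0%N, true)); (1 - q, (0%N, false))].

Definition uniform (n : nat) : rcomp nat :=
  [seq (n%:R^-1, (0%N, i)) | i <- iota 0 n].

(* Index [i] is drawn with probability w_i / sum_j w_j. *)
Definition proportional (w : seq nat) : rcomp nat :=
  [seq ((nth 0%N w i)%:R / (sumn w)%:R, (0%N, i)) | i <- iota 0 (size w)].

(* Peak space in the worst case over the random choices that have positive
   probability. *)
Definition worst_case_space (A : Type) (c : rcomp A) : nat :=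
  \max_(x <- c | 0 < x.1) x.2.1.

End Computations.

Declare Scope comp_scope.
Delimit Scope comp_scope with comp.
Notation "x <- c ;; k" := (bind c (fun x => k))
  (at level 100, c at next level, right associativity) : comp_scope.
Notation "c ;;; k" := (bind c (fun _ => k))
  (at level 100, right associativity) : comp_scope.
Local Open Scope comp_scope.

Section HTCountP.
Context (R : realFieldType) (V : choiceType).

Local Notation hyperedge := {fset V}.

Definition usage (G : seq hyperedge) : nat := (\sum_(f <- G) #|` f|)%N.

Record subset := Subset {
  Gs : seq hyperedge;
  alloc : nat;
  cnt : nat
}.

Definition subset0 : subset := Subset [::] 0 0.

(* The subset numbered i = 1, ..., l is at position i - 1 of [subs], so that
   l = size (subs s). *)
Record state := State {
  subs : seq subset;
  canExtend : bool;
  ests : R * R * R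
}.

(* Space is counted in words: a vertex, a number, a flag or a reference takes
   one word.  A stored hyperedge takes its vertices and its length. *)
Definition hyperedge_words (f : hyperedge) : nat := #|` f|.+1.

(* The four extra words are |G_s[i]|, M_s[i], M'[i] and m[i]. *)
Definition subset_words (S : subset) : nat :=
  (\sum_(f <- Gs S) hyperedge_words f + 4)%N.

(* Scratch registers: the 13 registers of [scan_registers], 3 vertex cursors
   with which intersection sizes are counted in place, the flag telling whether
   the hyperedge being processed is in the sample, the last random draw, and two
   accumulators for the sums in the tests. *)
Definition register_words : nat := 20.

(* The eight extra words are M, N, tau, l, canExtend and the three estimates.
   The hyperedge being processed belongs to the input: it is charged only once
   it is copied into a list. *)
Definition words_in_use (s : state) : nat :=
  (\sum_(T <- subs s) subset_words T + 8 + register_words)%N.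

Definition get (s : state) (i : nat) : subset := nth subset0 (subs s) i.

Definition set_subset (s : state) (i : nat) (S : subset) : state :=
  State (set_nth subset0 (subs s) i S) (canExtend s) (ests s).

Definition set_list (s : state) (i : nat) (G : seq hyperedge) : state :=
  set_subset s i (Subset G (alloc (get s i)) (cnt (get s i))).

Definition set_flag (s : state) (b : bool) : state :=
  State (subs s) b (ests s).

Definition set_ests (s : state) (x : R * R * R) : state :=
  State (subs s) (canExtend s) x.

Definition delete (i : nat) (G : seq hyperedge) : seq hyperedge :=
  take i G ++ drop i.+1 G.

(* The sampling subroutine; [mem G] is the space in use when the list being
   worked on is G.  While removals are in progress the sample consists of the
   list G together with, if [b], the arriving hyperedge e, which is still read
   from the input; e is copied into the list when the budget is met. *)
Section Sample.
Context (mem : seq hyperedge -> nat) (e : hyperedge) (B : nat).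

Definition commit (G : seq hyperedge) (b : bool) : seq hyperedge :=
  if b then rcons G e else G.

(* Every round removes one element and the empty sample is within budget, so
   [fuel = size G + b] rounds are enough. *)
Fixpoint evict (fuel : nat) (G : seq hyperedge) (b : bool) :
    rcomp R (seq hyperedge * bool) :=
  occupy R (mem G) ;;;
  if (usage G + (if b then #|` e| else 0) <= B)%N then
    occupy R (mem (commit G b)) ;;; ret R (commit G b, b)
  else if fuel is fuel'.+1 then
    i <- uniform R (size G + b) ;;
    if (i < size G)%N then evict fuel' (delete i G) b else evict fuel' G false
  else ret R (G, false).

(* Result: the new list, whether e was accepted, and whether e is still stored
   (an accepted e may itself be removed by the eviction loop). *)
Definition sample_hyperedge (m : nat) (G : seq hyperedge) :
    rcomp R (seq hyperedge * bool * bool) :=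
  if ((usage G + #|` e| <= B) && (size G == m - 1))%N then
    occupy R (mem (rcons G e)) ;;; ret R (rcons G e, true, true)
  else
    accept <- flip ((size G)%:R / m%:R) ;;
    if accept then
      i <- uniform R (size G) ;;
      let G' := delete i G in
      r <- evict (size G').+1 G' true ;;
      ret R (r.1, true, r.2)
    else occupy R (mem G) ;;; ret R (G, false, false).

End Sample.

(* Per subset: |G_s[i]|, M_s[i], M'[i], m[i]. *)
Definition table (s : state) : seq (nat * nat * nat * nat) :=
  [seq (size (Gs T), usage (Gs T), alloc T, cnt T) | T <- subs s].

(* One elementary update of the three estimates, from the table, the registers
   of the scan and the current estimates. *)
Definition estimate_rule :=
  seq (nat * nat * nat * nat) -> seq nat -> R * R * R -> R * R * R.

Definition positions (s : state) : seq (nat * nat) :=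
  [seq (k, i) | k <- iota 0 (size (subs s)), i <- iota 0 (size (Gs (get s k)))].

Definition edge_at (s : state) (x : nat * nat) : hyperedge :=
  nth fset0 (Gs (get s x.1)) x.2.

Definition scan_registers (s : state) (p : nat) (e : hyperedge) (stored : bool)
    (x y : nat * nat) : seq nat :=
  let f := edge_at s x in let g := edge_at s y in
  [:: stored : nat; p; x.1; x.2; y.1; y.2; #|` e|; #|` f|; #|` g|;
      #|` (e `&` f)%fset|; #|` (e `&` g)%fset|; #|` (f `&` g)%fset|;
      #|` (e `&` f `&` g)%fset| ].

Section Algorithm.
Context (M N : nat) (tau : R) (rule : estimate_rule).

(* The list of position pairs only unfolds two nested loops; the pair reached by
   the loops is held in registers. *)
Fixpoint scan (s : state) (p : nat) (e : hyperedge) (stored : bool)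
    (xys : seq ((nat * nat) * (nat * nat))) : rcomp R state :=
  if xys is (x, y) :: xys' then
    occupy R (words_in_use s) ;;;
    scan (set_ests s (rule (table s) (scan_registers s p e stored x y) (ests s)))
         p e stored xys'
  else ret R s.

Definition update_estimates (s : state) (p : nat) (e : hyperedge)
    (stored : bool) : rcomp R state :=
  scan s p e stored [seq (x, y) | x <- positions s, y <- positions s].

Definition total_usage (s : state) : nat := (\sum_(T <- subs s) usage (Gs T))%N.

Definition extend (s : state) : state :=
  let S := last subset0 (subs s) in
  if [&& (size (subs s) < N)%N, canExtend s, (size (Gs S) < cnt S)%N
      & (total_usage s)%:R / M%:R < tau]
  then
    let old := [seq Subset (Gs T) (usage (Gs T)) (cnt T) | T <- subs s] in
    State (rcons old (Subset [::] (M - sumn [seq alloc T | T <- old]) 0))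
          false (ests s)
  else s.

(* Division by zero yields 0, so a subset that has seen no hyperedge has
   rate 0. *)
Definition rate (S : subset) : R := (size (Gs S))%:R / (cnt S)%:R.

Definition choose_subset (s : state) : rcomp R (nat * state) :=
  let l := size (subs s) in
  if (l == 1)%N
     || (rate (get s l.-1) < (l.-1)%:R^-1 * \sum_(k < l.-1) rate (get s k))
  then ret R (l.-1, s)
  else p <- proportional R [seq alloc T | T <- subs s] ;;
       ret R (p, set_flag s true).

Definition insert (s : state) (p : nat) (e : hyperedge) : rcomp R state :=
  let S := get s p in
  let m := (cnt S).+1 in
  let s' := set_subset s p (Subset (Gs S) (alloc S) m) in
  r <- sample_hyperedge (fun G => words_in_use (set_list s' p G)) e (alloc S) m (Gs S) ;;
  let: (G, accepted, stored) := r in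
  let s'' := set_list s' p G in
  if accepted then update_estimates s'' p e stored else ret R s''.

Definition arrival (s : state) (e : hyperedge) : rcomp R state :=
  let s1 := extend s in
  occupy R (words_in_use s1) ;;;
  c <- choose_subset s1 ;;
  s2 <- insert c.2 c.1 e ;;
  occupy R (words_in_use s2) ;;; ret R s2.

Fixpoint process (s : state) (es : seq hyperedge) : rcomp R state :=
  if es is e :: es' then s' <- arrival s e ;; process s' es' else ret R s.

Definition initial : state := State [:: Subset [::] M 0] true (0, 0, 0).

Definition htcount_p (es : seq hyperedge) : rcomp R state :=
  occupy R (words_in_use initial) ;;; process initial es.

End Algorithm.
End HTCountP.

(* Main.v *)
Require Import Defs.
From mathcomp Require Import all_boot all_order all_algebra finmap.

(** Along every run, whatever the random draws, the allocations sum to at most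
    [M], every subset stays within its allocation, and stored hyperedges are
    nonempty.  A stored hyperedge [f] costs [#|f| + 1 <= 2 * #|f|] words, so the
    lists take at most [2 * M] words, and the rest takes [4 * N + 28]. *)

Set Implicit Arguments.
Unset Strict Implicit.
Unset Printing Implicit Defensive.

Import Order.TTheory GRing.Theory Num.Theory.
Local Open Scope ring_scope.

Section Outcomes.
Context (R : realFieldType) (K : nat).

(** A postcondition paired with a peak bound. Every listed outcome is constrained whatever its
    weight, which is stronger than what [worst_case_space] asks. *)
Definition outcomes (A : Type) (P : pred A) (c : rcomp R A) : bool :=
  all (fun x => (x.2.1 <= K)%N && P x.2.2) c.

(** The sequencing rule: [bind] combines peaks by [maxn], so one bound [K] serves both stages. *)
Lemma outcomes_bind (A B : Type) (P : pred A) (Q : pred B) (c : rcomp R A)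
    (k : A -> rcomp R B) :
  outcomes P c -> (forall a, P a -> outcomes Q (k a)) -> outcomes Q (bind c k).
Proof.
rewrite /outcomes /bind => + Hk; elim: c => //= x c IH /andP[/andP[xK Px] /IH Hc].
rewrite all_cat Hc andbT all_map.
apply: sub_all (Hk _ Px) => y /= /andP[yK ->].
by rewrite geq_max xK yK.
Qed.

Lemma outcomes_ret (A : Type) (P : pred A) (a : A) :
  outcomes P (ret R a) = P a.
Proof. by rewrite /outcomes /= andbT. Qed.

Lemma outcomes_occupy (A : Type) (P : pred A) (w : nat) (c : rcomp R A) :
  (w <= K)%N -> outcomes P c -> outcomes P (bind (occupy R w) (fun _ => c)).
Proof.
move=> wK Pc; apply: (@outcomes_bind _ _ predT) => //.
by rewrite /outcomes /= wK.
Qed.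

Lemma outcomes_flip (q : R) : outcomes predT (flip q).
Proof. by []. Qed.

Lemma outcomes_uniform (n : nat) : outcomes (fun i => i < n)%N (uniform R n).
Proof. by rewrite /outcomes all_map; apply/allP => i; rewrite mem_iota. Qed.

Lemma outcomes_proportional (w : seq nat) :
  outcomes (fun i => i < size w)%N (proportional R w).
Proof. by rewrite /outcomes all_map; apply/allP => i; rewrite mem_iota. Qed.

Lemma worst_case_space_le (A : Type) (P : pred A) (c : rcomp R A) :
  outcomes P c -> (worst_case_space c <= K)%N.
Proof.
rewrite /outcomes /worst_case_space; elim: c => [|x c IH]; first by rewrite big_nil.
move=> /= /andP[/andP[xK _] /IH Hc]; rewrite big_cons.
by case: ifP => // _; rewrite geq_max xK.
Qed.

End Outcomes.

Arguments outcomes : simpl never.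

Section Lists.
Context (V : choiceType).
Implicit Types (G : seq {fset V}) (e : {fset V}) (B : nat).

Definition fits B G : bool :=
  (usage G <= B)%N && all (fun f => f != fset0) G.

Lemma usage_cat G1 G2 : usage (G1 ++ G2) = (usage G1 + usage G2)%N.
Proof. by rewrite /usage big_cat. Qed.

Lemma usage_rcons G e : usage (rcons G e) = (usage G + #|` e|)%N.
Proof. by rewrite -cats1 usage_cat {2}/usage big_seq1. Qed.

Lemma fits_rcons B G e :
  fits B (rcons G e) =
  [&& (usage G + #|` e| <= B)%N, e != fset0 & all (fun f => f != fset0) G].
Proof. by rewrite /fits usage_rcons all_rcons. Qed.

Lemma fits_delete B i G : fits B G -> fits B (delete i G).
Proof.
have [leGi|ltiG] := leqP (size G) i.
  (* An index out of range deletes nothing. *)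
  by rewrite /delete take_oversize // drop_oversize ?cats0 // ltnW.
rewrite -{1}(cat_take_drop i G) (drop_nth fset0 ltiG) /fits /delete !usage_cat.
rewrite !all_cat /= => /andP[leB /and3P[-> _ ->]]; rewrite !andbT.
apply: leq_trans leB; rewrite leq_add2l -cat1s usage_cat.
exact: leq_addl.
Qed.

Lemma fits_words B G :
  fits B G -> (\sum_(f <- G) hyperedge_words f <= 2 * B)%N.
Proof.
move=> /andP[leB /allP G0]; apply: leq_trans (leq_mul (leqnn 2) leB).
(* Both sums are restricted to members of [G], so that nonemptiness can pay for the length word. *)
rewrite /usage big_distrr /= big_seq [leqRHS]big_seq; apply: leq_sum => f /G0 f0.
by rewrite /hyperedge_words mul2n -addnn -add1n leq_add2r cardfs_gt0.
Qed.

End Lists.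

Section Sampling.
Context (R : realFieldType) (V : choiceType) (K : nat).
Context (mem : seq {fset V} -> nat) (e : {fset V}) (B : nat).
Context (memK : forall G, fits B G -> (mem G <= K)%N) (e0 : e != fset0).

Lemma fits_commit G b :
  fits B G -> (usage G + (if b then #|` e| else 0) <= B)%N ->
  fits B (commit e G b).
Proof. by case: b => //= /andP[_ G0] leB; rewrite fits_rcons leB e0. Qed.

(** Removals keep [G] within budget, and [e] joins it only at the commit, right after a test that
    leaves room for it. The induction generalizes [b] because a round may drop [e] itself. *)
Lemma outcomes_evict fuel G b :
  fits B G -> outcomes K (fun r => fits B r.1) (evict R mem e B fuel G b).
Proof.
elim: fuel G b => [|fuel IH] G b fG /=;
    apply: outcomes_occupy; rewrite ?memK //.
  (* Out of fuel and over budget, [G] is returned without [e], so it still fits. *)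
  case: ifP => leB; last by rewrite outcomes_ret.
  by apply: outcomes_occupy; rewrite ?outcomes_ret ?memK ?fits_commit.
case: ifP => leB.
  by apply: outcomes_occupy; rewrite ?outcomes_ret ?memK ?fits_commit.
apply: outcomes_bind (outcomes_uniform _ _ _) _ => i _.
by case: ifP => _; apply: IH => //; apply: fits_delete.
Qed.

Lemma outcomes_sample m G :
  fits B G ->
  outcomes K (fun r => fits B r.1.1) (sample_hyperedge R mem e B m G).
Proof.
move=> fG; rewrite /sample_hyperedge; case: ifP => [/andP[leB _]|_].
  have fC : fits B (rcons G e) by rewrite fits_rcons leB e0; case/andP: fG.
  by apply: outcomes_occupy; rewrite ?memK // outcomes_ret.
apply: outcomes_bind (outcomes_flip _ _) _ => -[] _; last first.
  by apply: outcomes_occupy; rewrite ?memK // outcomes_ret.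
apply: outcomes_bind (outcomes_uniform _ _ _) _ => i _.
(* A removal comes first, so eviction starts from a list that fits. *)
apply: outcomes_bind (outcomes_evict _ _ (fits_delete i fG)) _ => r fr.
by rewrite outcomes_ret.
Qed.

End Sampling.

Section Invariant.
Context (R : realFieldType) (V : choiceType) (M N : nat).
Implicit Types (s : state R V) (T : Defs.subset V).

(** The lower bound on the number of subsets makes the last position a valid index; the upper bound
    caps the fixed cost of four words per subset. *)
Definition well_allocated s : bool :=
  [&& (0 < size (subs s) <= N)%N,
      (sumn [seq alloc T | T <- subs s] <= M)%N
    & all (fun T => fits (alloc T) (Gs T)) (subs s)].

(** Here 28 is the 8 global words plus the 20 of [register_words]. *)
Definition space_bound : nat := (2 * M + (4 * N + 28))%N.

Lemma well_allocated_words s :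
  well_allocated s -> (words_in_use s <= space_bound)%N.
Proof.
move=> /and3P[/andP[_ leN] leM fitS].
rewrite /words_in_use -addnA /space_bound [leqRHS]addnA leq_add2r.
have leS : (\sum_(T <- subs s) subset_words T
    <= 2 * sumn [seq alloc T | T <- subs s] + 4 * size (subs s))%N.
  elim: (subs s) fitS => [|T S IH] /=; first by rewrite big_nil.
  move=> /andP[fT /IH leS]; rewrite big_cons mulnDr mulnS addnACA.
  by rewrite leq_add // /subset_words leq_add2r fits_words.
by apply: leq_trans leS _; rewrite leq_add // leq_mul2l.
Qed.

Lemma well_allocated_get s p :
  well_allocated s -> (p < size (subs s))%N ->
  fits (alloc (get s p)) (Gs (get s p)).
Proof. by move=> /and3P[_ _ /all_nthP]; apply. Qed.

(** The allocation at [p] is kept, so the sum of allocations is unchanged and only the new list has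
    to be checked. *)
Lemma well_allocated_set s p T :
  well_allocated s -> (p < size (subs s))%N ->
  alloc T = alloc (get s p) -> fits (alloc T) (Gs T) ->
  well_allocated (set_subset s p T).
Proof.
move=> /and3P[leN leM fitS] ltp eqT fT.
rewrite /well_allocated /= size_set_nth (maxn_idPr ltp) leN /=.
rewrite set_nthE ltp map_cat /= eqT.
rewrite -{1 2}(cat_take_drop p (subs s)) (drop_nth (Defs.subset0 V) ltp) in leM fitS.
rewrite map_cat /= in leM; rewrite leM all_cat /= fT.
by move: fitS; rewrite all_cat /= => /and3P[-> _ ->].
Qed.

Lemma size_set_subset s p T :
  (p < size (subs s))%N -> size (subs (set_subset s p T)) = size (subs s).
Proof. by move=> ltp; rewrite /= size_set_nth (maxn_idPr ltp). Qed.

(** Each old allocation shrinks to its usage, so the old ones still sum to at most [M]; the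
    truncated subtraction is then exact and the new total is [M]. *)
Lemma well_allocated_extend tau s :
  well_allocated s -> well_allocated (extend M N tau s).
Proof.
rewrite /extend => Hs; case: ifP => // /and4P[ltN _ _ _].
case/and3P: Hs => _ leM fitS; rewrite /well_allocated /= size_rcons size_map ltN /=.
rewrite map_rcons all_rcons sumn_rcons -map_comp all_map /=.
apply/and3P; split; first rewrite subnKC //.
- apply: leq_trans leM; elim: (subs s) fitS => //= T S IH /andP[/andP[leT _] /IH].
  exact: leq_add.
- by rewrite /fits /usage big_nil.
- by apply: sub_all fitS => T /andP[_ T0]; rewrite /= /fits /= leqnn.
Qed.

Local Notation bounded := (outcomes space_bound).

(** A scan rewrites only the estimates, whose word count is fixed. *)
Lemma bounded_scan rule s p e stored xys :
  well_allocated s -> bounded well_allocated (scan rule s p e stored xys).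
Proof.
elim: xys s => [|[x y] xys IH] s Hs /=; first by rewrite outcomes_ret.
by apply: outcomes_occupy; [apply: well_allocated_words | apply: IH].
Qed.

Lemma bounded_choose s :
  well_allocated s ->
  bounded (fun c => well_allocated c.2 && (c.1 < size (subs c.2))%N)
    (choose_subset s).
Proof.
move=> Hs; rewrite /choose_subset; case: ifP => _.
  by rewrite outcomes_ret /= Hs; case/and3P: Hs => /andP[l0 _] _ _; rewrite prednK /=.
apply: outcomes_bind (outcomes_proportional _ _ _) _ => p; rewrite size_map => ltp.
by rewrite outcomes_ret ltp andbT.
Qed.

Lemma bounded_insert rule s p e :
  well_allocated s -> (p < size (subs s))%N -> e != fset0 ->
  bounded well_allocated (insert rule s p e).
Proof.
move=> Hs ltp e0; rewrite /insert; set s' := set_subset _ _ _.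
have fp := well_allocated_get Hs ltp.
have Hs' : well_allocated s' by apply: well_allocated_set.
have ltp' : (p < size (subs s'))%N by rewrite size_set_subset.
have aE : alloc (get s' p) = alloc (get s p) by rewrite /get nth_set_nth /= eqxx.
(* This serves twice: it bounds the space function handed to the sampler, and it restores the
   invariant on the sampler's result. *)
have HG G : fits (alloc (get s p)) G -> well_allocated (set_list s' p G).
  by move=> fG; apply: well_allocated_set => //=; rewrite aE.
apply: (@outcomes_bind _ _ _ _ (fun r => fits (alloc (get s p)) r.1.1)).
  by apply: outcomes_sample => // G /HG; apply: well_allocated_words.
move=> [[G a] b] /= /HG HsG.
by case: a; rewrite ?outcomes_ret //; apply: bounded_scan.
Qed.

Lemma bounded_process tau rule s es :
  well_allocated s -> all (fun e => e != fset0) es ->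
  bounded well_allocated (process M N tau rule s es).
Proof.
elim: es s => [|e es IH] s Hs /=; first by rewrite outcomes_ret.
move=> /andP[e0 es0]; apply: (@outcomes_bind _ _ _ _ well_allocated) => [|s' Hs'];
  last exact: IH.
have He := well_allocated_extend tau Hs.
apply: outcomes_occupy; first exact: well_allocated_words.
apply: outcomes_bind (bounded_choose He) _ => c /andP[Hc ltc].
apply: outcomes_bind (bounded_insert rule Hc ltc e0) _ => s2 Hs2.
by apply: outcomes_occupy; rewrite ?outcomes_ret ?well_allocated_words.
Qed.

Lemma well_allocated_initial : (0 < N)%N -> well_allocated (initial R V M).
Proof.
by move=> N0; rewrite /well_allocated /= N0 addn0 leqnn /fits /usage big_nil.
Qed.

End Invariant.

Unset Implicit Arguments.

Theorem theorem5p5 :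
  exists C : nat, forall N : nat, exists M0 : nat,
  forall (R : realFieldType) (V : choiceType) (M : nat) (tau : R)
         (rule : estimate_rule R) (stream : seq {fset V}),
    (0 < N)%N -> (M0 <= M)%N -> 0 < tau < 1 ->
    (forall e : {fset V}, e \in stream -> e != fset0) ->
    (worst_case_space (htcount_p M N tau rule stream) <= C * M)%N.
Proof.
(* Once [M] is at least the overhead [4 * N + 28], that overhead costs one more [M] on top of
   [2 * M], so the constant 3 does not depend on [N]. *)
exists 3 => N; exists (4 * N + 28)%N => R V M tau rule stream N0 leM _ es0.
have leK : (space_bound M N <= 3 * M)%N.
  by rewrite /space_bound (mulnDl 2 1) mul1n leq_add2l.
have H0 := well_allocated_initial R V M N0.
apply: leq_trans leK.
apply: (@worst_case_space_le _ _ _ (@well_allocated R V M N)).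
apply: outcomes_occupy; first exact: well_allocated_words H0.
by apply: bounded_process H0 _; apply/allP.
Qed.
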